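(* In the non-separable Hilbert space $\ell_2([0,1]\times\{0,1,2,\dots\})$ there exists a universal dictionary.
   Context: $\ell_2(T)$ denotes the Hilbert space of square-summable scalar families indexed by the set $T$. Let $H$ be a Hilbert space with norm $|\cdot|$. A dictionary in $H$ is a subset $D$ of the unit sphere of $H$ with $\overline{\mathrm{span}}\,D=H$. For $m\in\mathbb{N}=\{1,2,\dots\}$, $\Sigma_m(D)=\{\sum_{k=1}^m\lambda_kg_k:\ \lambda_k\text{ scalars},\ g_k\in D\}$, $\sigma_m(x)=\mathrm{dist}(x,\Sigma_m(D))$ for $x\in H$, and $\sigma_0(x)=|x|$. A dictionary $D$ in $H$ is called universal if for every strictly decreasing real sequence $\alpha_0>\alpha_1>\dots$ with $\alpha_m\to0$ there exists $x\in H$ with $\sigma_m(x)=\alpha_m$ for all $m=0,1,2,\dots$ *)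

(* Defs.v *)
From HB Require Import structures.
From mathcomp Require Import all_boot all_order all_algebra.
From mathcomp Require Import complex ring.
From mathcomp Require Import all_classical all_reals all_analysis.

Set Implicit Arguments.
Unset Strict Implicit.
Unset Printing Implicit Defensive.

Import Order.TTheory GRing.Theory Num.Theory.
Import numFieldNormedType.Exports.

Local Open Scope classical_set_scope.
Local Open Scope ring_scope.

(* The norm of a [normedModType K] takes its values in [K]; a scalar field
   comes with the embedding of R into it and the R-valued absolute value, so
   that norms and distances can be read off in R.  Only the two instances
   [real_scalars] and [complex_scalars] are used. *)
Record scalars (R : realType) := Scalars {
  scalar_field :> numFieldType;
  of_real : {rmorphism R -> scalar_field};
  modulus : scalar_field -> R;
  modulusE : forall z, `|z| = of_real (modulus z);
  ler_of_real : forall x y, (of_real x <= of_real y) = (x <= y)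
}.

Definition real_scalars (R : realType) : scalars R :=
  @Scalars R R idfun Num.norm (fun=> erefl) (fun _ _ => erefl).

Lemma complex_modulusE (R : realType) (z : R[i]) :
  `|z| = real_complex R (ComplexField.Normc.normc z).
Proof. by case: z => a b; rewrite normc_def. Qed.

Definition complex_scalars (R : realType) : scalars R :=
  @Scalars R R[i] (real_complex R) (@ComplexField.Normc.normc R)
    (@complex_modulusE R) (@lecR R).

Section scalars_theory.
Variables (R : realType) (K : scalars R).
Implicit Types (z w : K) (x y : R).

Lemma modulus_ge0 z : 0 <= modulus z.
Proof. by rewrite -(ler_of_real K) rmorph0 -modulusE. Qed.

Lemma of_real_inj : injective (@of_real R K).
Proof. exact: fmorph_inj. Qed.

Lemma modulus_eq0 z : modulus z = 0 -> z = 0.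
Proof. by move=> z0; apply/eqP; rewrite -normr_eq0 modulusE z0 rmorph0. Qed.

Lemma modulus0 : modulus (0 : K) = 0.
Proof. by apply: of_real_inj; rewrite -modulusE normr0 rmorph0. Qed.

Lemma modulusM z w : modulus (z * w) = modulus z * modulus w.
Proof. by apply: of_real_inj; rewrite rmorphM -!modulusE normrM. Qed.

Lemma modulus_of_real x : modulus (of_real K x) = `|x|.
Proof.
suff nonneg y : 0 <= y -> modulus (of_real K y) = y.
  have [x0|/ltW x0] := leP 0 x; first by rewrite nonneg// ger0_norm.
  rewrite ler0_norm// -[RHS]nonneg ?oppr_ge0//; apply: of_real_inj.
  by rewrite -!modulusE rmorphN normrN.
move=> y0; apply: of_real_inj.
by rewrite -modulusE ger0_norm// -(rmorph0 (of_real K)) ler_of_real.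
Qed.

Lemma ler_modulusD z w : modulus (z + w) <= modulus z + modulus w.
Proof. by rewrite -(ler_of_real K) rmorphD -!modulusE ler_normD. Qed.

End scalars_theory.

Section sqsum.
Variables (R : realType) (T : choiceType).
Implicit Types f g h : T -> R.

Definition sqsum f : \bar R := \esum_(t in [set: T]) (f t ^+ 2)%:E.

Lemma sqsum_ge0 f : (0 <= sqsum f)%E.
Proof. by apply: esum_ge0 => t _; rewrite lee_fin sqr_ge0. Qed.

Lemma sqsum_fineK f : (sqsum f < +oo)%E -> (fine (sqsum f))%:E = sqsum f.
Proof. by move=> fy; rewrite fineK// ge0_fin_numE// sqsum_ge0. Qed.

Lemma sqsum_cst0 : sqsum (cst 0) = 0%E.
Proof. by apply: esum1 => t _; rewrite expr0n. Qed.

Lemma sqsum_ge f t : ((f t ^+ 2)%:E <= sqsum f)%E.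
Proof.
rewrite -(esum_set1 (a := fun t => (f t ^+ 2)%:E)) ?lee_fin ?sqr_ge0//.
by apply: esum_ge; exists [set t]; [split=> //; exact: finite_set1|
  rewrite esum_set1 ?lee_fin ?sqr_ge0// fsbig_set1].
Qed.

Lemma sqsum_eq0 f : sqsum f = 0%E -> f = cst 0.
Proof.
move=> f0; apply/funext => t; apply/eqP; rewrite -sqrf_eq0 eq_le sqr_ge0 andbT.
by have := sqsum_ge f t; rewrite f0 lee_fin.
Qed.

Lemma le_esumZ c (a : T -> R) : 0 <= c -> (forall t, 0 <= a t) ->
  (\esum_(t in [set: T]) (c * a t)%:E
   <= c%:E * \esum_(t in [set: T]) (a t)%:E)%E.
Proof.
move=> c0 a0; apply: ge_ereal_sup => _ [A As <-].
under eq_fsbigr do rewrite EFinM.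
rewrite -ge0_mule_fsumr; last by move=> t; rewrite lee_fin.
by rewrite lee_pmul ?lee_fin ?fsume_ge0//; [move=> *; rewrite lee_fin|
  apply: esum_ge; exists A].
Qed.

Lemma sqsumZ c f : sqsum (fun t => c * f t) = ((c ^+ 2)%:E * sqsum f)%E.
Proof.
have le (k : R) g : (sqsum (fun t => k * g t)%R <= (k ^+ 2)%:E * sqsum g)%E.
  rewrite /sqsum; under eq_esum do rewrite exprMn.
  by apply: le_esumZ => [|t]; exact: sqr_ge0.
have [->|c0] := eqVneq c 0.
  rewrite expr0n mul0e -[RHS]sqsum_cst0; congr sqsum.
  by apply/funext => t; rewrite mul0r.
apply/eqP; rewrite eq_le le/=.
have {1}-> : f = (fun t => c^-1 * (c * f t)).
  by apply/funext => t; rewrite mulKf.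
have c2 : (0 < (c ^+ 2)%:E)%E by rewrite lte_fin exprn_even_gt0.
apply: (le_trans (lee_wpmul2l (ltW c2) (le _ _))).
by rewrite muleA -EFinM exprVn divff ?sqrf_eq0// mul1e.
Qed.

Lemma sqsumD f g h : (forall t, 0 <= h t <= f t + g t) ->
  (forall t, 0 <= f t) -> (forall t, 0 <= g t) ->
  (sqsum f < +oo)%E -> (sqsum g < +oo)%E ->
  (sqsum h
   <= ((Num.sqrt (fine (sqsum f)) + Num.sqrt (fine (sqsum g))) ^+ 2)%:E)%E.
Proof.
have le_sq (u v : T -> R) : (forall t, 0 <= u t <= v t) ->
    (sqsum u <= sqsum v)%E.
  move=> uv; apply: le_esum => t _; have /andP[u0 uvt] := uv t.
  by rewrite lee_fin ler_sqr// nnegrE ?(le_trans u0).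
have sq_fine (u : T -> R) : (sqsum u < +oo)%E ->
    ((Num.sqrt (fine (sqsum u))) ^+ 2)%:E = sqsum u.
  by move=> uy; rewrite sqr_sqrtr ?sqsum_fineK ?fine_ge0 ?sqsum_ge0.
move=> hfg f0 g0 fy gy.
have Ef := sq_fine _ fy; have Eg := sq_fine _ gy.
set p := Num.sqrt (fine (sqsum f)) in Ef *.
set q := Num.sqrt (fine (sqsum g)) in Eg *.
have [p0|p0] := eqVneq p 0.
  have fE : f = cst 0 by apply: sqsum_eq0; rewrite -Ef p0 expr0n.
  by rewrite p0 add0r Eg; apply: le_sq => t; have := hfg t; rewrite fE add0r.
have [q0|q0] := eqVneq q 0.
  have gE : g = cst 0 by apply: sqsum_eq0; rewrite -Eg q0 expr0n.
  by rewrite q0 addr0 Ef; apply: le_sq => t; have := hfg t; rewrite gE addr0.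
have {}p0 : 0 < p by rewrite lt_neqAle eq_sym p0 sqrtr_ge0.
have {}q0 : 0 < q by rewrite lt_neqAle eq_sym q0 sqrtr_ge0.
pose cf := (p + q) / p; pose cg := (p + q) / q.
have cf0 : 0 <= cf by rewrite divr_ge0 ?addr_ge0 ?ltW.
have cg0 : 0 <= cg by rewrite divr_ge0 ?addr_ge0 ?ltW.
apply: (@le_trans _ _ (\esum_(t in [set: T])
    ((cf * f t ^+ 2)%:E + (cg * g t ^+ 2)%:E))%E).
  apply: le_esum => t _; rewrite -EFinD lee_fin.
  have /andP[h0 hle] := hfg t.
  have : h t ^+ 2 <= (f t + g t) ^+ 2.
    by rewrite ler_sqr// nnegrE addr_ge0.
  move/le_trans; apply; rewrite -subr_ge0.
  have -> : cf * f t ^+ 2 + cg * g t ^+ 2 - (f t + g t) ^+ 2 =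
      (q * f t - p * g t) ^+ 2 / (p * q).
    rewrite /cf /cg; field; by rewrite !gt_eqF.
  by rewrite divr_ge0 ?sqr_ge0 ?mulr_ge0 ?ltW.
rewrite esumD; last 2 first.
- by move=> t _; rewrite lee_fin mulr_ge0 ?sqr_ge0.
- by move=> t _; rewrite lee_fin mulr_ge0 ?sqr_ge0.
have -> : (p + q) ^+ 2 = cf * p ^+ 2 + cg * q ^+ 2.
  rewrite /cf /cg; field; by rewrite !gt_eqF.
rewrite EFinD (EFinM cf) (EFinM cg) Ef Eg.
by apply: leeD; apply: le_esumZ => // t; exact: sqr_ge0.
Qed.

End sqsum.

Section ell2.
Variables (R : realType) (K : scalars R) (T : choiceType).

Definition square_summable : {pred (T -> K)} :=
  mem [set f : T -> K | (sqsum (fun t => modulus (f t)) < +oo)%E].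

Record ell2 := Ell2 {
  ell2_fun :> T -> K;
  ell2P : ell2_fun \in square_summable
}.

HB.instance Definition _ := [isSub for ell2_fun].
HB.instance Definition _ := [Choice of ell2 by <:].

Lemma square_summable_submod_closed : submod_closed square_summable.
Proof.
split.
  rewrite inE/= [X in sqsum X](_ : _ = cst 0) ?sqsum_cst0//.
  by apply/funext => t; rewrite modulus0.
move=> a f g; rewrite !inE/= => fy gy.
apply: le_lt_trans (ltry ((Num.sqrt (fine (sqsum (fun t =>
   modulus a * modulus (f t)))) + Num.sqrt (fine (sqsum (fun t =>
   modulus (g t))))) ^+ 2)).
apply: sqsumD => //.
- by move=> t; rewrite modulus_ge0 -modulusM/= ler_modulusD.
- by move=> t; rewrite mulr_ge0 ?modulus_ge0.
- by move=> t; rewrite modulus_ge0.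
- by rewrite sqsumZ lte_mul_pinfty// lee_fin sqr_ge0.
Qed.

HB.instance Definition _ := GRing.isSubmodClosed.Build _ _ square_summable
  square_summable_submod_closed.
HB.instance Definition _ := [SubChoice_isSubLmodule of ell2 by <:].

Definition ell2_norm (f : ell2) : R :=
  Num.sqrt (fine (sqsum (fun t => modulus (f t)))).

Let lty (f : ell2) : (sqsum (fun t => modulus (f t)) < +oo)%E.
Proof. by have := ell2P f; rewrite inE. Qed.

Lemma ler_ell2_normD (f g : ell2) :
  of_real K (ell2_norm (f + g))
  <= of_real K (ell2_norm f) + of_real K (ell2_norm g).
Proof.
rewrite -rmorphD ler_of_real.
have nfg0 : 0 <= ell2_norm f + ell2_norm g by rewrite addr_ge0 ?sqrtr_ge0.
rewrite -[leRHS]ger0_norm// -sqrtr_sqr; apply: ler_wsqrtr.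
rewrite -lee_fin sqsum_fineK//; apply: sqsumD => //.
- by move=> t; rewrite modulus_ge0 ler_modulusD.
- by move=> t; rewrite modulus_ge0.
- by move=> t; rewrite modulus_ge0.
Qed.

Lemma ell2_normZ (a : K) (f : ell2) :
  of_real K (ell2_norm (a *: f)) = `|a| * of_real K (ell2_norm f).
Proof.
rewrite modulusE -rmorphM; congr (of_real K _).
have -> : ell2_norm (a *: f) =
    Num.sqrt (fine (sqsum (fun t => modulus a * modulus (f t)))).
  by congr (Num.sqrt (fine (sqsum _))); apply/funext => t; rewrite -modulusM.
rewrite sqsumZ fineM ?ge0_fin_numE ?sqsum_ge0 ?ltry ?lee_fin ?sqr_ge0//.
by rewrite sqrtrM ?sqr_ge0// sqrtr_sqr ger0_norm ?modulus_ge0.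
Qed.

Lemma ell2_norm_eq0 (f : ell2) : of_real K (ell2_norm f) = 0 -> f = 0.
Proof.
move/eqP; rewrite fmorph_eq0 sqrtr_eq0 => f0.
apply/val_inj/funext => t; apply: modulus_eq0.
have /(congr1 (@^~ t)) -> // : (fun t => modulus (f t)) = cst 0.
apply: sqsum_eq0; rewrite -sqsum_fineK//; congr EFin.
by apply/eqP; rewrite eq_le f0 fine_ge0// sqsum_ge0.
Qed.

HB.instance Definition _ := Lmodule_isNormed.Build K ell2
  ler_ell2_normD ell2_normZ ell2_norm_eq0.

End ell2.

Section dictionary.
Variables (R : realType) (K : scalars R) (H : normedModType K).
Implicit Types (D A : set H) (x : H) (m : nat).

Definition rnorm x : R := modulus `|x|.

Definition dist x A : R := inf [set rnorm (x - y) | y in A].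

(* Sigma_m(D); the g_k need not be distinct, and Sigma 0 D = {0}. *)
Definition Sigma m D : set H :=
  [set x | exists (l : 'I_m -> K) (g : 'I_m -> H),
    (forall k, D (g k)) /\ x = \sum_(k < m) l k *: g k].

Definition lin_span D : set H := \bigcup_m Sigma m D.

Definition dictionary D :=
  (forall g, D g -> rnorm g = 1) /\ closure (lin_span D) = [set: H].

Definition sigma D m x : R := if m is 0 then rnorm x else dist x (Sigma m D).

Definition universal D :=
  dictionary D /\
  forall a : nat -> R, (forall m, a m.+1 < a m) -> a @ \oo --> (0 : R) ->
  exists x : H, forall m, sigma D m x = a m.

End dictionary.

(* The norm of the normed module [ell2 K T], read in R, is the l_2 norm. *)
Lemma rnorm_ell2E (R : realType) (K : scalars R) (T : choiceType)
    (f : ell2 K T) :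
  rnorm f
  = Num.sqrt (fine (\esum_(t in [set: T]) (modulus (f t) ^+ 2)%:E)).
Proof. by rewrite /rnorm [LHS]modulus_of_real ger0_norm ?sqrtr_ge0. Qed.

(* Main.v *)
Require Import Defs.
From HB Require Import structures.
From mathcomp Require Import all_boot all_order all_algebra.
From mathcomp Require Import finmap ring lra.
From mathcomp Require Import all_classical all_reals all_analysis.

(** Split the space into fibres, one copy of l_2(nat) with basis e_0, e_1, ...
for each i in the unit interval.  There are only continuum many strictly
decreasing null sequences, so each of them can be given a fibre of its own, and
the dictionary is a union of dictionaries of the fibres.  As a dictionary
element of another fibre is orthogonal to the fibre of i, it does not help to
approximate a vector of that fibre.  It remains to realise one sequence a in
one fibre ([prescribed_errors] glues the fibres).

In the fibre take x = sum_l x_l e_l with x_l = sqrt (a_l^2 - a_(l+1)^2) > 0, so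
that a_m is the distance from x to span(e_0, ..., e_(m-1)).  For the orthonormal
basis itself this would be the m-term error only if the x_l decreased, so the
e_l are replaced by a triangular system h_0, h_1, ..., with
span(h_0, ..., h_(m-1)) = span(e_0, ..., e_(m-1)), for which no other choice of
m elements does better than this one.  The system is defined by

  e_l = sum_(j <= l) lam_l^(j+1) h_j

where the bases lam_0, lam_1, ... are chosen one after the other, each one large
in terms of the earlier ones.  For any b, the vector v with coordinates
v_l = sum_(j <= l) b_j lam_l^(j+1) satisfies <v, h_n> = b_n
([triangular_values]); hence v annihilates h_n for n in A as soon as b vanishes
on A.

Let A be a set of m indices below N.  The crucial fact ([rows_controlled]) is
that some b vanishing on A gives v_l = x_l for m <= l < N and
0 <= v_l <= 2 x_l for l < m.  For y in the span of the h_n, n in A, and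
w = |x - y| coordinatewise, <v, x> = <v, x - y> <= <v, w>, whence

  sum w_l^2 >= sum (2 v_l w_l - v_l^2) >= sum v_l (2 x_l - v_l)
            >= sum_(m <= l < N) x_l^2 = a_m^2 - a_N^2

and N can be taken arbitrarily large ([controlled_bound], [target_far]).

The crucial fact is proved by induction on N, together with the solvability of
the linear system v_l = c_l, m <= l < N, for arbitrary c.  If the new index N is
not in A, then b_N is free and serves to adjust v_N.  If N is in A, let j0 be the
largest index below N outside A.  When lam_N is large, the equation for v_N
almost forces b_(j0) to vanish, so that b is a small perturbation of the solution
for A + {j0}, which has the same m but no constraint at N.  The bounds on
v_l, l < m, are strict for that solution, hence survive the perturbation, except
when j0 is the only free index; then v is a small positive multiple of the
column of j0 ([step_taken]). *)

Set Implicit Arguments.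
Unset Strict Implicit.
Unset Printing Implicit Defensive.

Import Order.TTheory GRing.Theory Num.Theory.
Import numFieldNormedType.Exports.

Local Open Scope classical_set_scope.
Local Open Scope ring_scope.

(** * Triangular systems with rapidly growing rows *)

Definition upd (T : Type) (f : nat -> T) n y : nat -> T :=
  fun k => if k == n then y else f k.

Lemma upd_lt (T : Type) (f : nat -> T) n y k : (k < n)%N -> upd f n y k = f k.
Proof. by move=> kn; rewrite /upd ltn_eqF. Qed.

Lemma upd_same (T : Type) (f : nat -> T) n y : upd f n y n = y.
Proof. by rewrite /upd eqxx. Qed.

(** The defining functional sees only the earlier values, the others being
replaced by [y0]. *)
Lemma course_of_values_rec (T : Type) (y0 : T) (F : nat -> (nat -> T) -> T) :
  exists h, forall n, h n = F n (fun k => if (k < n)%N then h k else y0).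
Proof.
pose g := fix g n := if n is n'.+1 then upd (g n') n' (F n' (g n')) else fun=> y0.
pose h n := F n (g n).
exists h => n; rewrite {1}/h; congr (F n _); apply/funext => k.
elim: n k => [//|n IH] k /=; rewrite /upd ltnS leq_eqVlt IH.
by case: eqVneq => //= ->.
Qed.

Section rows.
Variable R : realFieldType.
Implicit Types (t : R) (lam b c x : nat -> R) (A : pred nat).

(** The coordinate v_l of the vector v whose inner products with h_0, h_1, ...
are the b_j. *)
Definition col_sum lam b l : R := \sum_(j < l.+1) b j * lam l ^+ j.+1.

Lemma col_sum_eq lam lam' b b' l : lam l = lam' l ->
  (forall j, (j <= l)%N -> b j = b' j) -> col_sum lam b l = col_sum lam' b' l.
Proof.
by move=> e eb; apply: eq_bigr => j _; rewrite e eb // -ltnS.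
Qed.

Lemma col_sumD lam b c s l :
  col_sum lam (fun j => b j + s * c j) l = col_sum lam b l + s * col_sum lam c l.
Proof.
rewrite /col_sum big_distrr -big_split; apply: eq_bigr => j _ /=.
by rewrite mulrDl mulrA.
Qed.

Lemma col_sum0 lam b l : (forall j, (j <= l)%N -> b j = 0) -> col_sum lam b l = 0.
Proof. by move=> b0; apply: big1 => j _; rewrite b0 ?mul0r // -ltnS. Qed.

Definition solves lam A N c b :=
  (forall j, (j < N)%N -> A j -> b j = 0) /\
  forall l, (count A (iota 0 N) <= l < N)%N -> col_sum lam b l = c l.

(** When no j <= i lies outside A, the coordinate v_i is 0 for every b vanishing
on A; in all other cases the inequalities have to be strict in order to survive
a perturbation. *)
Definition controlled lam A N x b :=
  forall i, (i < count A (iota 0 N))%N -> (exists2 j, (j <= i)%N & ~~ A j) ->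
  0 < col_sum lam b i < 2 * x i.

Definition admissible lam x N A :=
  (forall c, exists b, solves lam A N c b) /\
  exists2 b, solves lam A N x b & controlled lam A N x b.

Definition all_admissible lam x N := forall A, admissible lam x N A.

Lemma count_iota_le A N : (count A (iota 0 N) <= N)%N.
Proof. by rewrite -{2}(size_iota 0 N) count_size. Qed.

Lemma admissible_eq lam lam' x N A A' :
  (forall l, (l < N)%N -> lam l = lam' l) ->
  (forall l, (l < N)%N -> A l = A' l) ->
  admissible lam x N A -> admissible lam' x N A'.
Proof.
move=> e eA.
have cE : count A (iota 0 N) = count A' (iota 0 N).
  by apply: eq_in_count => j; rewrite mem_iota => /eA.
have hE c b : solves lam A N c b -> solves lam' A' N c b.
  move=> [h1 h2]; split=> [j jN|l]; first by rewrite -eA//; exact: h1.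
  rewrite -cE => lN; rewrite -h2 //; apply: col_sum_eq => //.
  by rewrite e //; case/andP: lN.
move=> [s [b hb bb]]; split=> [c|].
  by have [b0 hb0] := s c; exists b0; exact: hE.
exists b; first exact: hE.
move=> i; rewrite -cE => im [j ji nA].
have iN : (i < N)%N by apply: leq_trans im (count_iota_le _ _).
rewrite -(@col_sum_eq lam lam' b b i) //; last exact: e.
by apply: bb => //; exists j => //; rewrite eA // (leq_ltn_trans ji).
Qed.

(** The coefficient b_N is free and occurs in no coordinate below N: it adjusts
v_N. *)
Lemma step_free lam x N A t : 0 < t -> ~~ A N ->
  admissible lam x N A -> admissible (upd lam N t) x N.+1 A.
Proof.
move=> t0 nAN [s [b hb bb]].
have cE : count A (iota 0 N.+1) = count A (iota 0 N).
  by rewrite -addn1 iotaD count_cat /= add0n (negbTE nAN) !addn0.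
pose ext c b := upd b N ((c N - \sum_(j < N) b j * t ^+ j.+1) / t ^+ N.+1).
have low c b' l : (l < N)%N -> col_sum (upd lam N t) (ext c b') l = col_sum lam b' l.
  move=> lN; apply: col_sum_eq => [|j jl]; first by rewrite upd_lt.
  by rewrite /ext upd_lt // (leq_ltn_trans jl).
have hE c b' : solves lam A N c b' -> solves (upd lam N t) A N.+1 c (ext c b').
  move=> [h1 h2]; split=> [j|l]; rewrite ltnS.
    rewrite leq_eqVlt => /predU1P[->|jN]; first by rewrite (negbTE nAN).
    by rewrite /ext upd_lt //; exact: h1.
  rewrite cE [(l <= N)%N]leq_eqVlt => /andP[ml /predU1P[->|lN]]; last by rewrite low// h2 ?ml.
  rewrite /col_sum big_ord_recr /= !upd_same.
  rewrite (eq_bigr (fun j : 'I_N => b' j * t ^+ j.+1)); last first.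
    by move=> j _; rewrite /ext upd_lt.
  by rewrite /ext upd_same divfK ?subrKC // expf_neq0 ?gt_eqF.
split=> [c|]; first by have [b' /hE] := s c; exists (ext c b').
exists (ext x b); first exact: hE.
move=> i; rewrite cE => im ex; rewrite low ?bb //.
exact: leq_trans im (count_iota_le _ _).
Qed.

Lemma sum_exp_bound t b n : 1 <= t ->
  `|\sum_(j < n) b j * t ^+ j.+1| <= (\sum_(j < n) `|b j|) * t ^+ n.
Proof.
move=> t1; rewrite mulr_suml; apply: le_trans (ler_norm_sum _ _ _) _.
apply: ler_sum => j _; rewrite normrM ler_wpM2l // normrX.
by rewrite ger0_norm ?(le_trans ler01)// ler_weXn2l.
Qed.

(** The power t^(n+1) dominates all lower ones, so the quotient is O(1/t).  It
will be the size of the correction which restores the equation for v_N. *)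
Lemma dominance (c : R) b (z : nat -> R) n (eps : R) : 0 < eps ->
  exists2 L : R, 0 < L & forall t, L < t ->
    0 < t ^+ n.+1 + \sum_(j < n) z j * t ^+ j.+1 /\
    `|(c - \sum_(j < n) b j * t ^+ j.+1) /
      (t ^+ n.+1 + \sum_(j < n) z j * t ^+ j.+1)| < eps.
Proof.
move=> eps0.
pose Z := \sum_(j < n) `|z j|; pose C := `|c| + \sum_(j < n) `|b j|.
have Z0 : 0 <= Z by apply: sumr_ge0.
have C0 : 0 <= C by rewrite addr_ge0 ?sumr_ge0.
have Ce0 : 0 <= C / eps by rewrite divr_ge0 // ltW.
exists (1 + Z + C / eps) => [|t Lt]; first by lra.
have t1 : 1 <= t by lra.
have tn : 1 <= t ^+ n by rewrite exprn_ege1.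
have zb := sum_exp_bound z n t1; have bb := sum_exp_bound b n t1.
set sz := \sum_(j < n) z j * _ in zb *; set sb := \sum_(j < n) b j * _ in bb *.
have den : t ^+ n * (t - Z) <= t ^+ n.+1 + sz.
  have := ler_norm (- sz); rewrite normrN exprSr mulrBr => h.
  by rewrite lerD2l lerNl (le_trans h) // mulrC.
have tZ : 0 < t - Z by lra.
have den0 : 0 < t ^+ n.+1 + sz.
  by apply: lt_le_trans den; rewrite mulr_gt0 // (lt_le_trans ltr01).
split=> //; rewrite normrM normfV (gtr0_norm den0) ltr_pdivrMr //.
have num : `|c - sb| <= C * t ^+ n.
  apply: le_trans (ler_normB _ _) _; rewrite mulrDl lerD //.
  by rewrite ler_peMr.
apply: le_lt_trans num _.
apply: lt_le_trans (_ : eps * (t ^+ n * (t - Z)) <= _); last by rewrite ler_pM2l.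
rewrite mulrCA mulrC ltr_pM2l ?(lt_le_trans ltr01)//.
have : C / eps < t - Z by lra.
by rewrite ltr_pdivrMr // mulrC.
Qed.

Lemma col_sum_trunc lam b n l : (n <= l.+1)%N ->
  (forall j, (n <= j <= l)%N -> b j = 0) ->
  col_sum lam b l = \sum_(j < n) b j * lam l ^+ j.+1.
Proof.
move=> nl b0; rewrite (big_ord_widen l.+1 (fun j => b j * lam l ^+ j.+1)) //.
rewrite /col_sum big_mkcond [RHS]big_mkcond /=; apply: eq_bigr => j _.
by case: ltnP => // nj; rewrite b0 ?mul0r // nj -ltnS ltn_ord.
Qed.

Lemma small_multiplier (u d : nat -> R) n : (forall i, (i < n)%N -> 0 < d i) ->
  exists2 eps, 0 < eps &
    forall s i, `|s| < eps -> (i < n)%N -> `|s * u i| < d i.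
Proof.
elim: n => [_|n IH dpos]; first by exists 1.
have [|eps e0 he] := IH; first by move=> i /ltnW; exact: dpos.
have dn := dpos n (leqnn _); have un : 0 < 1 + `|u n| by rewrite ltr_pwDl.
exists (Num.min eps (d n / (1 + `|u n|))); first by rewrite lt_min e0 divr_gt0.
move=> s i; rewrite lt_min => /andP[se sd]; rewrite ltnS leq_eqVlt.
case/predU1P => [->|]; last exact: he.
rewrite normrM; move: sd; rewrite ltr_pdivlMr //; apply: le_lt_trans.
by rewrite ler_wpM2l // lerDr.
Qed.

Lemma count_add A N j : (j < N)%N -> ~~ A j ->
  count [pred k | (k == j) || A k] (iota 0 N) = (count A (iota 0 N)).+1.
Proof.
move=> jN nA; have := count_predUI (pred1 j) A (iota 0 N).
rewrite [count (predI _ _) _](_ : _ = 0%N); last first.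
  apply/eqP; rewrite -leqn0 leqNgt -has_count; apply/hasPn => k _ /=.
  by case: eqVneq => // ->.
rewrite count_uniq_mem ?iota_uniq // mem_iota add0n jN addn0 add1n => <-.
by apply: eq_count.
Qed.

(** The solutions for A + {j0}, cut off above j0, are corrected along a vector z
with coefficient 1 at j0 whose coordinates between m and N vanish. *)
Lemma step_taken lam x N A : (forall l, (l < N)%N -> 0 < lam l) ->
  (forall l, 0 < x l) -> A N -> all_admissible lam x N ->
  exists2 L : R, 0 < L & forall t, L < t -> admissible (upd lam N t) x N.+1 A.
Proof.
move=> lam0 x0 AN gN.
have cE : count A (iota 0 N.+1) = (count A (iota 0 N)).+1.
  by rewrite -addn1 iotaD count_cat /= add0n AN addn0 addn1.
(* If A contains everything below N, there is no equation left. *)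
have [allA|] := pselect (forall j, (j < N)%N -> A j).
  have mN : count A (iota 0 N) = N.
    rewrite -{2}(size_iota 0 N); apply/eqP; rewrite -all_count.
    by apply/allP => j; rewrite mem_iota => /allA.
  have h0 c t : solves (upd lam N t) A N.+1 c (fun=> 0).
    by split=> // l; rewrite cE mN ltnS ltnNge andbC; case: leqP.
  exists 1 => // t _; split=> [c|]; exists (fun=> 0) => //.
  move=> i; rewrite cE mN ltnS leq_eqVlt => iN [j ji].
  have : (j <= N)%N by apply: leq_trans ji _; rewrite leq_eqVlt.
  by rewrite leq_eqVlt => /predU1P[->|/allA ->//]; rewrite AN.
move=> /existsNP[j1 /not_implyP[j1N /negP nA1]].
have exj : exists j, (j < N)%N && ~~ A j by exists j1; rewrite j1N.
have ubj j : (j < N)%N && ~~ A j -> (j <= N)%N by case/andP => /ltnW.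
have [j0 /andP[j0N nA0] j0max] := ex_maxnP exj ubj => {j1 j1N nA1 exj ubj}.
have above j : (j0 < j < N)%N -> A j.
  move=> /andP[j0j jN]; apply: contraLR j0j => nA.
  by rewrite -leqNgt j0max // jN.
pose A' := [pred k | (k == j0) || A k].
have cA' : count A' (iota 0 N) = (count A (iota 0 N)).+1 by exact: count_add.
have mN : ((count A (iota 0 N)).+1 <= N)%N by rewrite -cA' count_iota_le.
have [s' [b' hb' bb']] := gN A'.
(* A solution for A' need not vanish at N itself, which belongs to A. *)
pose cut (b : nat -> R) j := if (j < j0)%N then b j else 0.
have cutE c b l : solves lam A' N c b -> (l < N)%N ->
    col_sum lam (cut b) l = col_sum lam b l.
  move=> [h _] lN; apply: col_sum_eq => // j jl; rewrite /cut; case: ltnP => // jj.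
  have jN := leq_ltn_trans jl lN.
  rewrite h //=; move: jj; rewrite leq_eqVlt => /predU1P[->|jj].
    by rewrite eqxx.
  by rewrite above ?orbT // jj.
pose del j : R := (j == j0)%:R.
have [z' hz'] := s' (fun l => - col_sum lam del l).
pose z j := cut z' j + 1 * del j.
have zlow l : (count A (iota 0 N) < l < N)%N -> col_sum lam z l = 0.
  move=> /andP[ml lN]; rewrite /z col_sumD (cutE _ _ _ hz') //.
  by case: hz' => _ ->; [rewrite mul1r addNr | rewrite cA' ml].
have cut0 c b j : solves lam A' N c b -> (j < N.+1)%N -> A j -> cut b j = 0.
  move=> [h _] jN Aj; rewrite /cut; case: ifP => // jj0.
  by rewrite h // ?(ltn_trans jj0)//= Aj orbT.
have z0 j : (j < N.+1)%N -> A j -> z j = 0.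
  move=> jN Aj; rewrite /z (cut0 _ _ _ hz') // /del.
  by case: eqVneq => [jE|_]; [move: nA0; rewrite -jE Aj | rewrite mulr0 addr0].
have topcut b t : col_sum (upd lam N t) (cut b) N = \sum_(j < j0) b j * t ^+ j.+1.
  rewrite (@col_sum_trunc _ _ j0); first 1 last.
  - by rewrite ltnW // ltnS ltnW.
  - by move=> j /andP[]; rewrite leqNgt /cut => /negbTE ->.
  by rewrite upd_same; apply: eq_bigr => j _; rewrite /cut ltn_ord.
have topz t :
    col_sum (upd lam N t) z N = t ^+ j0.+1 + \sum_(j < j0) z' j * t ^+ j.+1.
  rewrite /z col_sumD topcut mul1r addrC; congr (_ + _).
  rewrite (@col_sum_trunc _ _ j0.+1); first 1 last.
  - by rewrite ltnS ltnW.
  - by move=> j /andP[j0j _]; rewrite /del gtn_eqF.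
  rewrite big_ord_recr /= big1 => [|j _]; last by rewrite /del ltn_eqF ?mul0r.
  by rewrite upd_same /del eqxx mul1r add0r.
(* [d i] is how much the coordinate i may move; if A' contains everything up to
   i, that coordinate starts from 0 and need only stay below 2 x_i. *)
pose u i := col_sum lam z i.
pose beta i := col_sum lam b' i.
pose d i := if pselect (exists2 j, (j <= i)%N & ~~ A' j) is left _
  then Num.min (beta i) (2 * x i - beta i) else 2 * x i.
have [|eps eps0 small] := @small_multiplier u d (count A (iota 0 N)).+1.
  move=> i im; rewrite /d; case: pselect => [ex|_]; last by rewrite mulr_gt0.
  have := bb' i; rewrite cA' => /(_ im ex)/andP[h1 h2].
  by rewrite lt_min h1 subr_gt0.
have [L L0 dom] := dominance (x N) b' z' j0 eps0.
exists L => // t /dom [] {dom}; set den := _ + _ => den0 seps.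
have corr c b : solves lam A' N c b ->
    solves (upd lam N t) A N.+1 c (fun j => cut b j +
      (c N - \sum_(j < j0) b j * t ^+ j.+1) / den * z j).
  move=> hb; split=> [j jN Aj|l]; first by rewrite (cut0 _ _ _ hb) // z0 // mulr0 addr0.
  rewrite cE ltnS => /andP[ml]; rewrite leq_eqVlt => /predU1P[->|lN].
    by rewrite col_sumD topcut topz -/den divfK ?subrKC // gt_eqF.
  rewrite (@col_sum_eq _ lam _ _ l (upd_lt _ _ lN) (fun _ _ => erefl)) col_sumD.
  rewrite zlow ?ml // mulr0 addr0 (cutE _ _ _ hb) //.
  by case: hb => _ -> //; rewrite cA' ml.
split=> [c|].
  by have [b /corr hb] := s' c; eexists; exact: hb.
eexists; first exact: corr hb'.
set s := _ / den in seps *.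
move=> i; rewrite cE => im [j ji nAj].
have iN : (i < N)%N by rewrite (leq_trans im).
rewrite (@col_sum_eq _ lam _ _ i (upd_lt _ _ iN) (fun _ _ => erefl)) col_sumD.
rewrite (cutE _ _ _ hb') // -/(beta i) -/(u i).
have := small s i seps im; rewrite /d ltr_norml.
case: pselect => [_|nex].
  rewrite lt_min => /andP[]; rewrite ltrNl lt_min => /andP[h1 h2] /andP[h3 h4].
  by apply/andP; split; lra.
move=> /andP[_ h].
(* Here j0 is the only free index up to i, and the correction is the whole
   solution: a positive multiple of the column of j0. *)
have A'i k : (k <= i)%N -> A' k.
  by move=> ki; apply/negPn/negP => nk; apply: nex; exists k.
have jE : j = j0.
  by have := A'i _ ji; rewrite /= (negbTE nAj) orbF => /eqP.
have b'0 k : (k < j0)%N -> b' k = 0 /\ z' k = 0.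
  move=> kj; have ki : (k <= i)%N by rewrite (leq_trans (ltnW kj)) // -jE.
  by split; [case: hb' | case: hz'] => -> //; rewrite ?(ltn_trans kj) ?A'i.
have -> : beta i = 0.
  rewrite /beta -(cutE _ _ _ hb') // col_sum0 // => k _; rewrite /cut.
  by case: ifP => // /b'0[].
rewrite add0r h andbT.
rewrite mulr_gt0 //.
  rewrite divr_gt0 // big1 ?subr0 // => k _.
  by have [-> _] := b'0 _ (ltn_ord k); rewrite mul0r.
rewrite /u /z col_sumD (@col_sum0 _ (cut z')) => [|k _]; last first.
  by rewrite /cut; case: ifP => // /b'0[].
rewrite add0r mul1r (@col_sum_trunc _ _ j0.+1); first 1 last.
- by rewrite ltnS -jE.
- by move=> k /andP[j0k _]; rewrite /del gtn_eqF.
rewrite big_ord_recr /= big1 => [|k _]; last by rewrite /del ltn_eqF ?mul0r.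
by rewrite /del eqxx mul1r add0r exprn_gt0 // lam0.
Qed.

(** The threshold for lam_N can be chosen independently of A, as only the
finitely many traces of A below N + 1 matter. *)
Lemma step_all lam x N : (forall l, (l < N)%N -> 0 < lam l) ->
  (forall l, 0 < x l) -> all_admissible lam x N ->
  exists2 t : R, 0 < t & all_admissible (upd lam N t) x N.+1.
Proof.
move=> lam0 x0 gN.
have step A : exists L : R, 0 < L /\
    forall t, L < t -> admissible (upd lam N t) x N.+1 A.
  have [AN|nAN] := boolP (A N).
    by have [L L0 hL] := step_taken lam0 x0 AN gN; exists L.
  by exists 1; split=> // t t1; apply: step_free => //; lra.
have [L hL] := choice step.
(* The sum of the thresholds of all traces exceeds each of them. *)
pose mask (f : {ffun 'I_N.+1 -> bool}) : pred nat :=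
  fun j => oapp f false (insub j).
pose t := 1 + \sum_f L (mask f).
have t0 : 0 < t by rewrite ltr_pwDl // sumr_ge0 // => f _; case: (hL (mask f)) => /ltW.
exists t => // A; pose f := [ffun j : 'I_N.+1 => A j].
apply: (@admissible_eq (upd lam N t) _ _ _ (mask f)) => //.
  by move=> l lN; rewrite /mask insubT /= ffunE.
apply: (hL (mask f)).2; rewrite /t (bigD1 f) //= addrCA ltrDl ltr_pwDl //.
by apply: sumr_ge0 => g _; case: (hL (mask g)) => /ltW.
Qed.

Lemma rows_admissible x : (forall l, 0 < x l) ->
  exists2 lam : nat -> R, (forall l, 0 < lam l) & forall N, all_admissible lam x N.
Proof.
move=> x0.
have next N lam : exists t : R, 0 < t /\ ((forall l, (l < N)%N -> 0 < lam l) ->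
    all_admissible lam x N -> all_admissible (upd lam N t) x N.+1).
  have [h|nh] := pselect ((forall l, (l < N)%N -> 0 < lam l) /\ all_admissible lam x N).
    by case: h => h1 h2; have [t t0 ht] := step_all h1 x0 h2; exists t.
  by exists 1; split=> // h1 h2; case: nh.
have [F hF] := choice (fun p : nat * (nat -> R) => next p.1 p.2).
have [lam lamE] := course_of_values_rec 1 (fun N lam => F (N, lam)).
have lam0 l : 0 < lam l.
  by rewrite lamE; exact: (hF (l, _)).1.
exists lam => //; elim=> [|N IH] A.
  by split=> [c|]; exists (fun=> 0) => //; split=> // l; rewrite ltn0 andbF.
pose lamN k := if (k < N)%N then lam k else 1.
have [_ /=] := hF (N, lamN); rewrite -lamE => step.
apply: (@admissible_eq (upd lamN N (lam N)) _ _ _ A) => // [l|].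
  by rewrite ltnS leq_eqVlt /lamN => /predU1P[->|lN];
    [rewrite upd_same|rewrite upd_lt ?lN].
apply: step => [l lN|B]; first by rewrite /lamN lN.
by apply: (@admissible_eq lam _ _ _ B) => // l lN; rewrite /lamN lN.
Qed.

Lemma rows_controlled x : (forall l, 0 < x l) ->
  exists2 lam : nat -> R, (forall l, 0 < lam l) &
    forall A N, exists2 b, solves lam A N x b &
      forall i, (i < count A (iota 0 N))%N -> 0 <= col_sum lam b i <= 2 * x i.
Proof.
move=> x0; have [lam lam0 gl] := rows_admissible x0; exists lam => // A N.
have [_ [b hb bb]] := gl N A; exists b => // i im.
have [ex|nex] := pselect (exists2 j, (j <= i)%N & ~~ A j).
  by case/andP: (bb i im ex) => /ltW -> /ltW ->.
rewrite col_sum0 ?lexx ?mulr_ge0 ?(ltW (x0 i)) // => j ji; case: hb => h _.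
apply: h; first by rewrite (leq_ltn_trans ji) // (leq_trans im) ?count_iota_le.
by apply/negPn/negP => nA; apply: nex; exists j.
Qed.

(** Termwise, w^2 >= 2 v w - v^2; the hypothesis replaces v w by v x, and
v (2 x - v) is nonnegative below m and equal to x^2 from m on. *)
Lemma controlled_bound m N x v (w : nat -> R) : (m <= N)%N ->
  (forall l, (m <= l < N)%N -> v l = x l) ->
  (forall l, (l < m)%N -> 0 <= v l <= 2 * x l) ->
  \sum_(l < N) v l * x l <= \sum_(l < N) v l * w l ->
  \sum_(m <= l < N) x l ^+ 2 <= \sum_(l < N) w l ^+ 2.
Proof.
move=> mN vx v2 vw.
apply: (@le_trans _ _ (\sum_(l < N) v l * (2 * x l - v l))).
  rewrite -(big_mkord xpredT (fun l => v l * (2 * x l - v l))).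
  rewrite [leRHS](@big_cat_nat _ _ _ m) //= ler_wpDl //.
    rewrite big_nat_cond sumr_ge0 // => l; rewrite andbT => /v2 /andP[h1 h2].
    by rewrite mulr_ge0 // subr_ge0.
  rewrite le_eqVlt; apply/orP; left; apply/eqP/eq_big_nat => l /vx ->; ring.
apply: (@le_trans _ _ (\sum_(l < N) (2 * (v l * w l) - v l ^+ 2))).
  rewrite -subr_ge0 -sumrB.
  rewrite (eq_bigr (fun l : 'I_N => 2 * (v l * w l - v l * x l))); last first.
    by move=> l _; ring.
  by rewrite -mulr_sumr mulr_ge0 // sumrB subr_ge0.
apply: ler_sum => l _; rewrite -subr_ge0.
have -> : w l ^+ 2 - (2 * (v l * w l) - v l ^+ 2) = (w l - v l) ^+ 2 by ring.
exact: sqr_ge0.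
Qed.

End rows.

(** * Norms and coordinates in l_2 *)

Lemma esum_ge_seq (R : realType) (T : choiceType) (f : T -> \bar R)
    (e : nat -> T) N : injective e ->
  (\sum_(l < N) f (e l) <= \esum_(t in [set: T]) f t)%E.
Proof.
move=> inj; apply: esum_ge; exists (e @` `I_N).
  by split=> //; apply: finite_image; exact: finite_II.
rewrite fsbig_image; last by move=> ? ? _ _ /inj.
by rewrite (fsbig_ord _ _ (fun l => f (e l))).
Qed.

Lemma esum_le_seq (R : realType) (T : choiceType) (f : T -> \bar R)
    (e : nat -> T) c : injective e -> (forall t, 0 <= f t)%E ->
  (forall t, ~ range e t -> f t = 0%E) ->
  (forall N, \sum_(l < N) f (e l) <= c)%E ->
  (\esum_(t in [set: T]) f t <= c)%E.
Proof.
move=> inj f0 supp fc.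
have -> : (\esum_(t in [set: T]) f t = \esum_(t in range e) f t)%E.
  rewrite [RHS]esum_mkcond; apply: eq_esum => t _; case: ifPn => // nt.
  by rewrite supp // => et; rewrite notin_setE in nt.
rewrite (esum_image _ e) => [|? ? _ _ /inj //].
rewrite -nneseries_esumT //; apply: lime_le.
  by apply: is_cvg_nneseries.
by apply: nearW => n; rewrite big_mkord.
Qed.

Section rnorm_theory.
Variables (R : realType) (K : scalars R).

Lemma rnormZ (H : normedModType K) (c : K) (f : H) :
  rnorm (c *: f) = modulus c * rnorm f.
Proof.
rewrite /rnorm normrZ modulusM modulusE modulus_of_real.
by rewrite ger0_norm ?modulus_ge0.
Qed.

Lemma rnorm_gt0 (H : normedModType K) (f : H) : f != 0 -> 0 < rnorm f.
Proof.
move=> f0; rewrite lt_neqAle modulus_ge0 andbT eq_sym.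
by apply: contra f0 => /eqP/modulus_eq0/eqP; rewrite normr_eq0.
Qed.

Lemma modulus_sum n (F : 'I_n -> K) :
  modulus (\sum_(l < n) F l) <= \sum_(l < n) modulus (F l).
Proof.
elim: n F => [|n IH] F; first by rewrite !big_ord0 modulus0.
rewrite !big_ord_recr /=; apply: le_trans (ler_modulusD _ _) _.
by rewrite lerD2r IH.
Qed.

Lemma rnorm_ge0 (H : normedModType K) (f : H) : 0 <= rnorm f.
Proof. exact: modulus_ge0. Qed.

Lemma norm_lt_rnorm (H : normedModType K) (f : H) (e : K) : 0 < e -> (`|f| < e) = (rnorm f < modulus e).
Proof.
move=> e0; have {1}-> : e = of_real K (modulus e).
  by rewrite -modulusE gtr0_norm.
have -> : `|f| = of_real K (rnorm f) :> K by rewrite -modulusE normr_id.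
by rewrite !lt_def ler_of_real (inj_eq (@of_real_inj _ _)).
Qed.

Variable T : choiceType.

Lemma rnorm_sqr (f : ell2 K T) :
  (rnorm f ^+ 2)%:E = sqsum (fun t => modulus (f t)).
Proof.
have fy : (sqsum (fun t => modulus (f t)) < +oo)%E.
  by have := ell2P f; rewrite inE.
by rewrite rnorm_ell2E sqr_sqrtr ?sqsum_fineK ?fine_ge0 ?sqsum_ge0.
Qed.

Lemma ell2D (f g : ell2 K T) t : (f + g) t = f t + g t.
Proof. by []. Qed.

Lemma ell2B (f g : ell2 K T) t : (f - g) t = f t - g t.
Proof. by []. Qed.

Lemma ell2Z (c : K) (f : ell2 K T) t : (c *: f) t = c * f t.
Proof. by []. Qed.

Lemma ell2_sum J (r : seq J) (F : J -> ell2 K T) t :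
  (\sum_(j <- r) F j) t = \sum_(j <- r) F j t.
Proof.
by elim: r => [|j r IH]; rewrite ?big_nil ?big_cons ?ell2D ?IH.
Qed.

End rnorm_theory.

Section fibres.
Variables (R : realType) (K : scalars R) (I : choiceType).
Local Notation H := (ell2 K (I * nat)%type).
Implicit Types (i : I) (u : nat -> R) (f : H).

(** The vector with coordinates u in the fibre i; the value is zero, as junk,
unless u is square summable. *)
Definition fibre i u : H :=
  insubd (0 : H) (fun q => if q.1 == i then of_real K (u q.2) else 0).

Definition sqr_bounded u c := forall N, \sum_(l < N) u l ^+ 2 <= c.

Lemma sqsum_fibre i u c : sqr_bounded u c ->
  (sqsum (fun q : I * nat =>
     modulus (if q.1 == i then of_real K (u q.2) else 0%R))
    <= c%:E)%E.
Proof.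
move=> uc; apply: (@esum_le_seq _ _ _ (fun l => (i, l))).
- by move=> l l' [].
- by move=> t; rewrite lee_fin sqr_ge0.
- move=> [i' l] /= nt; case: eqVneq nt => [->|_ _]; first by case; exists l.
  by rewrite modulus0 expr0n.
- move=> N; rewrite sumEFin lee_fin; apply: le_trans (uc N).
  by apply: ler_sum => l _; rewrite /= eqxx modulus_of_real real_normK ?num_real.
Qed.

Lemma fibreE i u c q : sqr_bounded u c ->
  fibre i u q = if q.1 == i then of_real K (u q.2) else 0.
Proof.
move=> uc; rewrite /fibre -[LHS]/(\val (insubd _ _) q) insubdK // inE /=.
exact: le_lt_trans (sqsum_fibre i uc) (ltry _).
Qed.

Lemma fibre_norm i u c : sqr_bounded u c -> rnorm (fibre i u) ^+ 2 <= c.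
Proof.
move=> uc; rewrite -lee_fin rnorm_sqr; apply: le_trans (sqsum_fibre i uc).
rewrite le_eqVlt; apply/orP; left; apply/eqP; congr sqsum.
by apply/funext => q; rewrite (fibreE _ _ uc).
Qed.

Lemma norm_ge_fibre i f N : \sum_(l < N) modulus (f (i, val l)) ^+ 2 <= rnorm f ^+ 2.
Proof.
rewrite -lee_fin rnorm_sqr -sumEFin.
apply: (esum_ge_seq (fun q => (modulus (f q) ^+ 2)%:E) (e := fun l => (i, l))).
by move=> l l' [].
Qed.

Definition unit_vec (p : I * nat) : H := fibre p.1 (fun l => (l == p.2)%:R).

Lemma delta_bounded n : sqr_bounded (fun l => (l == n)%:R) 1.
Proof.
move=> N; rewrite (eq_bigr (fun l : 'I_N => ((l == n :> nat)%:R : R))); last first.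
  by move=> l _; case: eqP; rewrite ?expr0n ?expr1n.
have [nN|Nn] := ltnP n N.
  rewrite (bigD1 (Ordinal nN)) //= eqxx big1 ?addr0 // => l.
  by rewrite -val_eqE /= => /negbTE ->.
by rewrite big1 // => l _; rewrite ltn_eqF // (leq_trans (ltn_ord l)).
Qed.

Lemma unit_vecE p q : unit_vec p q = (q == p)%:R.
Proof.
rewrite /unit_vec (fibreE _ _ (@delta_bounded _)).
case: p q => [i n] [j l] /=; rewrite xpair_eqE; case: eqP => //= _.
by case: eqP; rewrite ?rmorph1 ?rmorph0.
Qed.

(** Truncating at N makes every u, summable or not, a linear functional. *)
Definition pairing i N u (f : H) : K^o := \sum_(l < N) of_real K (u l) * f (i, val l).

Lemma pairing_linear i N u : linear (pairing i N u).
Proof.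
move=> c f g; rewrite /pairing scaler_sumr -big_split; apply: eq_bigr => l _ /=.
by rewrite mulrDr; congr (_ + _); exact: mulrCA.
Qed.

HB.instance Definition _ i N u :=
  GRing.isLinear.Build K H K^o _ (pairing i N u) (pairing_linear i N u).

Lemma pairing_unit i N u p :
  pairing i N u (unit_vec p) =
  if (p.1 == i) && (p.2 < N)%N then of_real K (u p.2) else 0.
Proof.
case: p => i' n; rewrite /pairing /=.
have [->|ni] := eqVneq i' i; last first.
  by rewrite big1 // => l _; rewrite unit_vecE xpair_eqE eq_sym (negbTE ni) mulr0.
case: ltnP => nN /=.
  rewrite (bigD1 (Ordinal nN)) //= unit_vecE eqxx mulr1 big1 ?addr0 // => l ln.
  by rewrite unit_vecE xpair_eqE eqxx -[_ == n]/(l == Ordinal nN) (negbTE ln) mulr0.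
rewrite big1 // => l _; rewrite unit_vecE xpair_eqE eqxx ltn_eqF ?mulr0 //.
by rewrite (leq_trans (ltn_ord l)).
Qed.

End fibres.

(** * The system h and its values *)

Lemma triangular_system (R : realType) (K : scalars R) (V : lmodType K)
    (e : nat -> V) (lam : nat -> R) : (forall l, 0 < lam l) ->
  exists h : nat -> V,
    forall n, e n = \sum_(j < n.+1) of_real K (lam n ^+ j.+1) *: h j.
Proof.
move=> lam0; have [h hE] := course_of_values_rec (0 : V) (fun n prev =>
  (of_real K (lam n ^+ n.+1))^-1 *:
  (e n - \sum_(j < n) of_real K (lam n ^+ j.+1) *: prev j)).
exists h => n; rewrite big_ord_recr /= hE scalerA divff ?scale1r; last first.
  by rewrite fmorph_eq0 gt_eqF // exprn_gt0.
rewrite [X in _ - X](eq_bigr (fun j : 'I_n => of_real K (lam n ^+ j.+1) *: h j)).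
  by rewrite subrKC.
by move=> j _; rewrite ltn_ord.
Qed.

(** Apply phi to the equation for e_n and compare with the definition of v_n: by
induction all terms but the last one agree. *)
Lemma triangular_values (R : realType) (K : scalars R) (V : lmodType K)
    (e h : nat -> V) (lam : nat -> R) (phi : {linear V -> K^o}) (b : nat -> R) N :
  (forall l, 0 < lam l) ->
  (forall n, e n = \sum_(j < n.+1) of_real K (lam n ^+ j.+1) *: h j) ->
  (forall n, (n < N)%N -> phi (e n) = of_real K (col_sum lam b n)) ->
  forall n, (n < N)%N -> phi (h n) = of_real K (b n).
Proof.
move=> lam0 eh phie n; elim/ltn_ind: n => n IH nN.
have := phie n nN; rewrite eh linear_sum /col_sum rmorph_sum !big_ord_recr /=.
have -> : \sum_(j < n) phi (of_real K (lam n ^+ j.+1) *: h j) =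
    \sum_(j < n) of_real K (b j * lam n ^+ j.+1) :> K.
  apply: eq_bigr => j _; rewrite linearZ IH ?(ltn_trans (ltn_ord j) nN) ?ltn_ord //.
  by rewrite rmorphM mulrC.
move=> /addrI; rewrite linearZ rmorphM [RHS]mulrC => /mulfI; apply.
by rewrite fmorph_eq0 gt_eqF // exprn_gt0.
Qed.

(** * The sequence of errors and the coordinates of the target *)

Section gaps.
Variables (R : realType) (a : nat -> R).
Hypotheses (a_decr : forall m, a m.+1 < a m) (a_lim : a @ \oo --> (0 : R)).

Definition gap l : R := Num.sqrt (a l ^+ 2 - a l.+1 ^+ 2).

Lemma errors_le m n : (m <= n)%N -> a n <= a m.
Proof.
elim: n => [|n IH]; first by rewrite leqn0 => /eqP ->.
rewrite leq_eqVlt => /predU1P[-> //|mn].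
exact: le_trans (ltW (a_decr n)) (IH mn).
Qed.

Lemma errors_gt0 m : 0 < a m.
Proof.
apply: le_lt_trans (a_decr m); rewrite -(cvg_lim (@Rhausdorff R) a_lim).
apply: nonincreasing_cvgn_ge; last by apply/cvg_ex; exists 0.
by move=> n p; exact: errors_le.
Qed.

Lemma gap_pos l : 0 < a l ^+ 2 - a l.+1 ^+ 2.
Proof. by rewrite subr_gt0 ltr_sqr ?nnegrE ?ltW ?errors_gt0. Qed.

Lemma gap_gt0 l : 0 < gap l.
Proof. by rewrite sqrtr_gt0 gap_pos. Qed.

Lemma sum_gap m N : (m <= N)%N ->
  \sum_(m <= l < N) gap l ^+ 2 = a m ^+ 2 - a N ^+ 2.
Proof.
move=> mN; rewrite -[RHS]opprB -(telescope_sumr (fun l => a l ^+ 2) mN) -sumrN.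
by apply: eq_bigr => l _; rewrite opprB sqr_sqrtr // ltW // gap_pos.
Qed.

Definition tail m l : R := if (l < m)%N then 0 else gap l.

Lemma tail_bounded m : sqr_bounded (tail m) (a m ^+ 2).
Proof.
move=> N; rewrite -(big_mkord xpredT (fun l => tail m l ^+ 2)).
have [Nm|/ltnW mN] := leqP N m.
  rewrite big_nat_cond big1 ?sqr_ge0 // => l; rewrite andbT /tail => /andP[_ lN].
  by rewrite (leq_trans lN Nm) expr0n.
rewrite (@big_cat_nat _ _ _ m) //= big_nat_cond big1 => [|l]; last first.
  by rewrite andbT /tail => /andP[_ ->]; rewrite expr0n.
rewrite add0r (eq_big_nat _ _ (F2 := fun l => gap l ^+ 2)).
  by rewrite sum_gap // gerBl sqr_ge0.
by move=> l /andP[ml _]; rewrite /tail ltnNge ml.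
Qed.

Lemma errors_le_of_sqr m r (N0 : nat) : 0 <= r ->
  (forall N, (N0 <= N)%N -> a m ^+ 2 - a N ^+ 2 <= r ^+ 2) -> a m <= r.
Proof.
move=> r0 h; rewrite -ler_sqr ?nnegrE ?(ltW (errors_gt0 _)) //.
apply/ler_addgt0Pr => e e0.
have e1 : 0 < Num.min e 1 by rewrite lt_min e0 /=.
have [N1 _ hN1] := @cvgr_lt _ _ _ _ _ _ a_lim _ e1.
have := h (maxn N0 N1) (leq_maxl _ _).
have := hN1 (maxn N0 N1) (leq_maxr _ _); rewrite lt_min => /andP[h1 h2].
have h3 := errors_gt0 (maxn N0 N1); nra.
Qed.
End gaps.

(** * The dictionary *)

Section linear_spans.
Variables (R : realType) (K : scalars R) (H : normedModType K).
Implicit Types D : set H.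

Lemma lin_span0 D : lin_span D 0.
Proof.
exists 0%N => //; exists (fun=> 0), (fun=> 0).
by split; [case | rewrite big_ord0].
Qed.

Lemma lin_spanD D f g : lin_span D f -> lin_span D g ->
  lin_span D (f + g).
Proof.
move=> [m _ [l [u [Du ->]]]] [n _ [l' [u' [Du' ->]]]].
exists (m + n)%N => //.
exists (fun k => match fintype.split k with inl k => l k | inr k => l' k end).
exists (fun k => match fintype.split k with inl k => u k | inr k => u' k end).
split; first by move=> k; case: (fintype.split k).
rewrite big_split_ord /=; congr (_ + _); apply: eq_bigr => k _.
  by rewrite -[lshift n k]/(unsplit (inl k)) unsplitK.
by rewrite -[rshift m k]/(unsplit (inr k)) unsplitK.
Qed.

Lemma lin_spanZ D c f : lin_span D f -> lin_span D (c *: f).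
Proof.
move=> [m _ [l [u [Du ->]]]]; exists m => //.
exists (fun k => c * l k), u; split=> //.
by rewrite scaler_sumr; apply: eq_bigr => k _; rewrite scalerA.
Qed.

Lemma lin_span_gen D g : D g -> lin_span D g.
Proof.
move=> Dg; exists 1%N => //; exists (fun=> 1), (fun=> g); split=> //.
by rewrite big_ord1 scale1r.
Qed.

Lemma lin_span_sum D (J : Type) (r : seq J) (F : J -> H) :
  (forall j, lin_span D (F j)) -> lin_span D (\sum_(j <- r) F j).
Proof.
move=> DF; elim/big_ind: _ => //; first exact: lin_span0.
exact: lin_spanD.
Qed.

End linear_spans.

Section construction.
Variables (R : realType) (K : scalars R) (I : choiceType).
Local Notation H := (ell2 K (I * nat)%type).

(** What is needed of the system h in the fibre i: it spans, other fibres do not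
see it, and for every finite A there is a functional u which certifies that the
h_n with n in A approximate x badly. *)
Definition adapted (x : nat -> R) (i : I) (h : nat -> H) :=
  [/\ forall n, exists c : nat -> K,
        unit_vec K (i, n) = \sum_(j < n.+1) c j *: h j,
      forall n, h n != 0,
      forall i' N u n, i' != i -> pairing i' N u (h n) = 0 &
      forall (A : pred nat) N, exists u : nat -> R,
        [/\ forall n, (n < N)%N -> A n -> pairing i N u (h n) = 0,
            forall l, (count A (iota 0 N) <= l < N)%N -> u l = x l &
            forall l, (l < count A (iota 0 N))%N -> 0 <= u l <= 2 * x l]].

Lemma adapted_exists x i : (forall l, 0 < x l) -> exists h, adapted x i h.
Proof.
move=> x0; have [lam lam0 hlam] := rows_controlled x0.
have [h hE] := triangular_system (fun n => unit_vec K (i, n)) lam0.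
have hval := fun phi b N => @triangular_values _ _ _ _ _ _ phi b N lam0 hE.
exists h; split.
- by move=> n; exists (fun j => of_real K (lam n ^+ j.+1)).
(* h_n has inner product 1 with the vector whose coefficients b_j are all 1. *)
- move=> n; apply/eqP => hn0.
  have := hval (pairing i n.+1 (col_sum lam (fun=> 1))) (fun=> 1) n.+1.
  move=> /(_ _ n (leqnn _)); rewrite hn0 linear0 rmorph1 => h0.
  have /eqP : 0 = 1 :> K; last by rewrite eq_sym oner_eq0.
  by apply: h0 => k kn; rewrite [LHS]pairing_unit /= eqxx kn.
- move=> i' N u n ii'.
  rewrite -[LHS]/((pairing i' N u : {linear H -> K^o}) (h n)).
  rewrite (hval _ (fun=> 0) n.+1) ?rmorph0 // => k _.
  rewrite [LHS]pairing_unit /= eq_sym (negbTE ii') /=.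
  by rewrite col_sum0 ?rmorph0.
- move=> A N; have [b [b0 bx] b2] := hlam A N.
  exists (col_sum lam b); split=> // n nN An.
  rewrite -[LHS]/((pairing i N (col_sum lam b) : {linear H -> K^o}) (h n)).
  rewrite (hval _ b N) ?b0 ?rmorph0 // => k kN.
  by rewrite [LHS]pairing_unit /= eqxx kN.
Qed.

(** Finite partial sums converge: the squared norm of a remainder is the part of
the unordered sum outside a finite set. *)
Lemma unit_vec_total (D : set H) : (forall p, lin_span D (unit_vec K p)) ->
  closure (lin_span D) = [set: H].
Proof.
move=> DE; apply/seteqP; split=> // f _ B /nbhs_ballP[e /= e0 eB].
pose F q : \bar R := (modulus (f q) ^+ 2)%:E.
have sE : \esum_(q in [set: I * nat]) F q = (rnorm f ^+ 2)%:E.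
  by rewrite rnorm_sqr.
have r0 : 0 < modulus e.
  rewrite lt_neqAle modulus_ge0 andbT eq_sym; apply: contraTneq e0.
  by move=> /modulus_eq0 ->; rewrite ltxx.
have r2 : 0 < modulus e ^+ 2 by rewrite exprn_gt0.
have := @ub_ereal_sup_adherent _ _ _ r2 (_ : \esum_(q in [set: I * nat]) F q \is a fin_num).
rewrite -/(esum _ _) sE => /(_ isT)[_ [X [finX _] <-] close].
pose g : H := \sum_(q <- fset_set X) f q *: unit_vec K q.
have gE p : g p = if p \in X then f p else 0.
  rewrite /g ell2_sum; case: ifPn => pX.
    rewrite (big_fsetD1 p) ?in_fset_set // ell2Z unit_vecE eqxx mulr1.
    rewrite big_seq big1 => [|q]; first exact: addr0.
    rewrite !inE => /andP[qp _].
    by rewrite ell2Z unit_vecE eq_sym (negbTE qp) mulr0.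
  rewrite big_seq big1 // => q; rewrite in_fset_set // => qX.
  rewrite ell2Z unit_vecE; case: eqVneq => [pq|]; rewrite ?mulr0 //.
  by move: pX; rewrite pq qX.
exists g; split.
  by apply: lin_span_sum => q; apply: lin_spanZ.
apply: eB; rewrite -ball_normE /ball_ /= norm_lt_rnorm //.
rewrite -ltr_sqr ?nnegrE ?rnorm_ge0 ?modulus_ge0 //.
rewrite -lte_fin rnorm_sqr.
have -> : sqsum (fun t => modulus ((f - g) t)) =
    (\esum_(q in [set: I * nat] `&` ~` X) F q)%E.
  rewrite setTI [RHS]esum_mkcond; apply: eq_esum => q _.
  rewrite ell2B gE in_setC; case: (q \in X); rewrite /= ?subr0 //.
  by rewrite subrr modulus0 expr0n.
have F0 q : (0 <= F q)%E by rewrite lee_fin sqr_ge0.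
have : (\esum_(q in [set: I * nat]) F q = \sum_(q \in X) F q +
    \esum_(q in [set: I * nat] `&` ~` X) F q)%E.
  by rewrite (esumID X) ?setTI ?(esum_fset finX).
rewrite sE; move: close; set S := (\sum_(_ \in _) _)%E; set W := \esum_(_ in _) _.
case: S W => [s||] [w||] //=.
rewrite -EFinB -EFinD !lte_fin => close [split].
by move: close; rewrite split; lra.
Qed.

(** The first m unit vectors of a fibre lie in the span of h_0, ..., h_(m-1). *)
Lemma unit_span (x : nat -> R) i (h : nat -> H) m (d : nat -> K) : adapted x i h ->
  exists c : nat -> K, \sum_(l < m) d l *: unit_vec K (i, val l) =
    \sum_(j < m) c j *: h j.
Proof.
move=> [hE _ _ _]; elim: m => [|m [c IH]].
  by exists (fun=> 0); rewrite !big_ord0.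
have [c' hc'] := hE m; exists (fun j => (if (j < m)%N then c j else 0) + d m * c' j).
rewrite big_ord_recr /= IH hc' scaler_sumr.
under [RHS]eq_bigr do rewrite scalerDl.
rewrite big_split /=; congr (_ + _); last first.
  by apply: eq_bigr => j _; rewrite scalerA.
rewrite big_ord_recr /= ltnn scale0r addr0; apply: eq_bigr => j _.
by rewrite ltn_ord.
Qed.

Definition normalized (h : I -> nat -> H) : set H :=
  [set (of_real K (rnorm (h p.1 p.2)))^-1 *: h p.1 p.2 | p in [set: I * nat]].

Section one_family.
Variables (a : I -> nat -> R) (h : I -> nat -> H).
Hypotheses (a_decr : forall i m, a i m.+1 < a i m)
  (a_lim : forall i, a i @ \oo --> (0 : R))
  (h_adapted : forall i, adapted (gap (a i)) i (h i)).
Local Notation D := (normalized h).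

Let h_neq0 i n : h i n != 0.
Proof. by case: (h_adapted i). Qed.

Let scale_neq0 i n : of_real K (rnorm (h i n)) != 0.
Proof. by rewrite fmorph_eq0 gt_eqF // rnorm_gt0. Qed.

Lemma normalized_dictionary : dictionary D.
Proof.
split=> [_ [[i n] _ <-]|].
  rewrite rnormZ; have hn0 := rnorm_gt0 (h_neq0 i n).
  apply: (mulfI (lt0r_neq0 hn0)); rewrite mulr1 mulrA -[X in X * _ * _]ger0_norm ?ltW //.
  by rewrite -(modulus_of_real K) -modulusM divff // -[1](rmorph1 (of_real K))
    modulus_of_real normr1 mul1r.
apply: unit_vec_total => -[i n].
have [/(_ n)[c ->] _ _ _] := h_adapted i.
apply: lin_span_sum => j; apply: lin_spanZ.
rewrite -[h i j]scale1r -(divff (scale_neq0 i j)) -scalerA.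
by apply: lin_spanZ; apply: lin_span_gen; exists (i, val j).
Qed.

Definition target i : H := fibre K i (tail (a i) 0).

Let targetE i j l : target i (j, l) = if j == i then of_real K (gap (a i) l) else 0.
Proof. by rewrite (fibreE _ _ _ (tail_bounded (a_decr i) (a_lim i) 0)). Qed.

(** The indices in the fibre i of the elements used form a set A of at most m
indices; elements of other fibres are annihilated by any functional of the fibre
i. *)
Lemma target_far i m y : Sigma m D y -> a i m <= rnorm (target i - y).
Proof.
move=> [c [g [Dg ->]]].
have /choice[p hp] k : exists q : I * nat,
    (of_real K (rnorm (h q.1 q.2)))^-1 *: h q.1 q.2 = g k.
  by have [q _ qE] := Dg k; exists q.
set y' := \sum_(k < m) _; set z := target i - y'.
pose A : pred nat := fun n => [exists k, p k == (i, n)].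
have Am N : (count A (iota 0 N) <= m)%N.
  rewrite -size_filter -[m in leqRHS](size_enum_ord m) -(size_map (fun k => (p k).2)).
  apply: uniq_leq_size; first by rewrite filter_uniq // iota_uniq.
  move=> n; rewrite mem_filter => /andP[/existsP[k /eqP pk] _].
  by apply/mapP; exists k; rewrite ?mem_enum ?pk.
pose N0 := (m + \sum_(k < m) (p k).2.+1)%N.
have pN0 k : ((p k).2 < N0)%N.
  by rewrite /N0 (bigD1 k) //= addnCA ltn_addr.
apply: (errors_le_of_sqr (a_decr i) (a_lim i) (N0 := N0)); first exact: rnorm_ge0.
move=> N N0N.
have [_ _ off /(_ A N)[u [uA ux u2]]] := h_adapted i.
have mN : (count A (iota 0 N) <= N)%N.
  by rewrite (leq_trans (Am N)) // (leq_trans _ N0N) // leq_addr.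
pose pr : {linear H -> K^o} := pairing i N u.
have pry : pr y' = 0.
  rewrite linear_sum big1 // => k _; rewrite -(hp k) !linearZ /=.
  suff -> : pr (h (p k).1 (p k).2) = 0 by rewrite !scaler0.
  have [pki|pki] := eqVneq (p k).1 i.
    rewrite pki; apply: uA; first exact: leq_trans (pN0 k) N0N.
    by apply/existsP; exists k; rewrite -pki -surjective_pairing.
  by have [_ _ offk _] := h_adapted (p k).1; apply: offk; rewrite eq_sym.
have x0 := gap_gt0 (a_decr i) (a_lim i).
have u0 l : (l < N)%N -> 0 <= u l.
  move=> lN; have [lA|Al] := ltnP l (count A (iota 0 N)).
    by case/andP: (u2 l lA).
  by rewrite ux ?Al // ltW.
apply: le_trans (norm_ge_fibre i z N).
have bound := @controlled_bound _ _ _ _ _ (fun l => modulus (z (i, l))) mN ux u2.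
apply: le_trans (bound _).
  by rewrite sum_gap // lerD2r ler_sqr ?nnegrE ?(ltW (errors_gt0 _ _ _)) // errors_le.
have prx : pr z = of_real K (\sum_(l < N) u l * gap (a i) l).
  rewrite /z linearB pry subr0 rmorph_sum; apply: eq_bigr => l _.
  by rewrite targetE eqxx rmorphM.
rewrite -[leLHS]ger0_norm; last first.
  by apply: sumr_ge0 => l _; rewrite mulr_ge0 ?u0 // ltW.
rewrite -(modulus_of_real K) -prx; apply: le_trans (modulus_sum _) _.
by apply: ler_sum => l _; rewrite modulusM modulus_of_real ger0_norm // u0.
Qed.

Lemma target_near i m : exists2 y, Sigma m D y & rnorm (target i - y) <= a i m.
Proof.
pose d l := of_real K (gap (a i) l).
have [c hc] := unit_span m d (h_adapted i).
exists (\sum_(l < m) d l *: unit_vec K (i, val l)).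
  exists (fun j => c j * of_real K (rnorm (h i j))).
  exists (fun j => (of_real K (rnorm (h i j)))^-1 *: h i j).
  split=> [j|]; first by exists (i, val j).
  by rewrite hc; apply: eq_bigr => j _; rewrite scalerA mulfK.
have -> : target i - \sum_(l < m) d l *: unit_vec K (i, val l) =
    fibre K i (tail (a i) m).
  apply/val_inj/funext => -[j l].
  rewrite -[LHS]/((target i - _) (j, l)) ell2B targetE ell2_sum.
  rewrite -[RHS]/(fibre K i _ (j, l)) (fibreE _ _ _ (tail_bounded _ _ m)) //.
  under eq_bigr do rewrite ell2Z unit_vecE xpair_eqE.
  case: eqVneq => [_|ji]; last by rewrite big1 ?subr0 // => k _; rewrite mulr0.
  rewrite /tail; case: ltnP => lm /=.
    rewrite (bigD1 (Ordinal lm)) //= eqxx mulr1 big1 => [|k].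
      by rewrite addr0 subrr rmorph0.
    by rewrite -val_eqE /= eq_sym => /negbTE ->; rewrite mulr0.
  rewrite big1 ?subr0 // => k _.
  by rewrite gtn_eqF ?mulr0 // (leq_trans (ltn_ord k)).
by rewrite -ler_sqr ?nnegrE ?rnorm_ge0 ?(ltW (errors_gt0 _ _ _)) // fibre_norm //; apply: tail_bounded.
Qed.

Lemma sigma_target i m : sigma D m (target i) = a i m.
Proof.
case: m => [|m] /=; apply/eqP; rewrite eq_le.
  apply/andP; split.
    have [y [l [g [_ ->]]]] := target_near i 0.
    by rewrite big_ord0 subr0.
  have := @target_far i 0 0; rewrite subr0; apply.
  by exists (fun=> 0), (fun=> 0); split; [case|rewrite big_ord0].
have lb : lbound [set rnorm (target i - y) | y in Sigma m.+1 D] (a i m.+1).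
  by move=> _ [y Dy <-]; exact: target_far.
have [y Dy ya] := target_near i m.+1.
apply/andP; split.
  apply: le_trans ya; apply: ge_inf; first by exists (a i m.+1).
  by exists y.
by apply: lb_le_inf => //; exists (rnorm (target i - y)), y.
Qed.
End one_family.

Theorem prescribed_errors (a : I -> nat -> R) :
  (forall i m, a i m.+1 < a i m) -> (forall i, a i @ \oo --> (0 : R)) ->
  exists2 D : set H, dictionary D &
    forall i, exists x : H, forall m, sigma D m x = a i m.
Proof.
move=> a_decr a_lim.
have [h h_adapted] := choice (fun i =>
  adapted_exists i (gap_gt0 (a_decr i) (a_lim i))).
exists (normalized h); first exact: (normalized_dictionary h_adapted).
by move=> i; exists (target a i) => m; exact: sigma_target.
Qed.

End construction.

(** * The unit interval indexes all sequences *)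

Section continuum.
Variable R : realType.
Implicit Types (b : nat -> bool) (n k : nat).

Definition ternary b n : R := \sum_(k < n) (b k)%:R * (2 * 3^-1 ^+ k.+1).

Lemma ternaryS b n : ternary b n.+1 = ternary b n + (b n)%:R * (2 * 3^-1 ^+ n.+1).
Proof. exact: big_ord_recr. Qed.

Lemma ternary_bounds b n d :
  ternary b n <= ternary b (n + d) <= ternary b n + 3^-1 ^+ n - 3^-1 ^+ (n + d).
Proof.
elim: d => [|d /andP[IH1 IH2]]; first by rewrite addn0 addrK !lexx.
have p : 0 < (3^-1 : R) ^+ (n + d) by rewrite exprn_gt0 // invr_gt0.
have e : (3^-1 : R) ^+ (n + d).+1 = 3^-1 ^+ (n + d) / 3 by rewrite exprSr.
rewrite addnS ternaryS e; move: IH1 IH2 p; move: (ternary b n) (ternary b _).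
move: (3^-1 ^+ n) (3^-1 ^+ (n + d)) => u v s t h1 h2 p.
by case: (b (n + d)%N); rewrite /= ?mul0r ?mul1r; apply/andP; split; lra.
Qed.

Definition cantor_code b : R := sup (range (ternary b)).

Lemma ternary_ub b n : ubound (range (ternary b)) (ternary b n + 3^-1 ^+ n).
Proof.
move=> _ [k _ <-]; have p j : 0 < (3^-1 : R) ^+ j by rewrite exprn_gt0 // invr_gt0.
have [kn|/ltnW nk] := leqP k n.
  have /andP[h _] := ternary_bounds b k (n - k).
  by rewrite subnKC // in h; have := p n; lra.
have /andP[_ h] := ternary_bounds b n (k - n).
by rewrite subnKC // in h; have := p k; lra.
Qed.

Lemma code_bounds b n : ternary b n <= cantor_code b <= ternary b n + 3^-1 ^+ n.
Proof.
have ne : range (ternary b) !=set0 by exists (ternary b 0), 0%N.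
apply/andP; split; last by apply: ge_sup => //; exact: ternary_ub.
apply: sup_upper_bound; last by exists n.
by split=> //; exists (ternary b n + 3^-1 ^+ n); exact: ternary_ub.
Qed.

Lemma code_unit b : cantor_code b \in `[0%R, 1%R]%classic.
Proof.
have := code_bounds b 0; rewrite /ternary big_ord0 add0r expr0 inE /=.
by rewrite in_itv.
Qed.

(** If b and b' first differ at k, their codes differ by at least
2/3^(k+1) - 1/3^(k+1). *)
Lemma cantor_code_inj : injective cantor_code.
Proof.
move=> b b' e; apply/funext => k; elim/ltn_ind: k => k IH.
have S : ternary b k = ternary b' k by apply: eq_bigr => j _; rewrite IH.
have := code_bounds b k.+1; have := code_bounds b' k.+1.
rewrite e !ternaryS S.
have p : 0 < (3^-1 : R) ^+ k.+1 by rewrite exprn_gt0 // invr_gt0.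
by case: (b k) (b' k) => [] [] //= /andP[h1 h2] /andP[h3 h4]; lra.
Qed.

(** All Dedekind cuts of the terms, as one sequence of bits. *)
Definition cuts (a : nat -> R) : nat -> bool := fun k =>
  if (choice.unpickle k : option (nat * rat)) is Some p then ratr p.2 < a p.1 else false.

Lemma cuts_inj : injective cuts.
Proof.
have main a a' : cuts a = cuts a' -> forall n, a n <= a' n.
  move=> e n; rewrite leNgt; apply/negP => /rat_in_itvoo[q].
  rewrite in_itv /= => /andP[h1 h2].
  have := congr1 (@^~ (choice.pickle (n, q))) e; rewrite /cuts choice.pickleK /= h2.
  by move=> /esym; rewrite ltNge (ltW h1).
move=> a a' e; apply/funext => n; apply/eqP.
by rewrite eq_le !main.
Qed.

Lemma unit_interval_covers (P : set (nat -> R)) a0 : P a0 ->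
  exists f : `[0%R : R, 1%R]%classic -> nat -> R,
    (forall t, P (f t)) /\ forall a, P a -> exists t, f t = a.
Proof.
move=> Pa0.
have /choice[f hf] (t : `[0%R : R, 1%R]%classic) : exists a, P a /\
    forall a', P a' -> cantor_code (cuts a') = set_val t -> a' = a.
  have [[a [Pa ta]]|no] := pselect (exists a, P a /\ cantor_code (cuts a) = set_val t).
    exists a; split=> // a' _ ta'; apply/cuts_inj/cantor_code_inj.
    by rewrite ta ta'.
  by exists a0; split=> // a' Pa' ta'; case: no; exists a'.
exists f; split=> [t|a Pa]; first by case: (hf t).
exists (SigSub (code_unit (cuts a))).
by apply/esym; case: (hf (SigSub (code_unit (cuts a)))) => _; apply.
Qed.
End continuum.

(** * Universality *)

Lemma universal_exists (R : realType) (K : scalars R) :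
  exists D : set (ell2 K (`[0%R : R, 1%R]%classic * nat)%type), universal D.
Proof.
(* Points which code no such sequence get the harmonic one. *)
pose P (a : nat -> R) := (forall m, a m.+1 < a m) /\ a @ \oo --> (0 : R).
have P0 : P (@harmonic R).
  split; last exact: cvg_harmonic.
  by move=> m; rewrite /= ltf_pV2 ?posrE ?ltr0n // ltr_nat.
have [f [fP fs]] := unit_interval_covers P0.
have [||D dD hD] := @prescribed_errors R K _ f.
- by move=> t; case: (fP t).
- by move=> t; case: (fP t).
exists D; split=> // a a1 a2.
have [t <-] := fs a (conj a1 a2); exact: hD.
Qed.

Theorem mainTheorem7 (R : realType) :
  (exists D : set (ell2 (real_scalars R) (`[0%R : R, 1%R]%classic * nat)%type),
     universal D) /\
  (exists D : set (ell2 (complex_scalars R) (`[0%R : R, 1%R]%classic * nat)%type),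
     universal D).
Proof. by split; exact: universal_exists. Qed.
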